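(* Let $d\in\mathbb N$, $\mathcal D=\{1,\dots,d\}$, $\mathbf u\subseteq\mathcal D$, let $w:\mathbb Z^d\to[1,\infty)$ be a weight function and $f\in \mathrm H^w(\mathbb T^d)$. Then for any weight function $w_{\mathbf u}:\mathbb Z^{|\mathbf u|}\to[1,\infty)$ with $$w_{\mathbf u}(\mathbf k_{\mathbf u})\le w(\mathbf k)\quad\text{for all }\mathbf k\in\mathbb Z^d\text{ with }\mathbf k_{\mathbf u^c}=\mathbf 0,$$ we have $\mathrm P_{\mathbf u}f\in \mathrm H^{w_{\mathbf u}}(\mathbb T^{|\mathbf u|})$ and $f_{\mathbf u}\in \mathrm H^{w_{\mathbf u}}(\mathbb T^{|\mathbf u|})$.
   Context: $\mathbb T=[0,1)$ with periodic identification; $c_{\mathbf k}(g)=\int_{\mathbb T^m} g(\mathbf x)e^{-2\pi i\mathbf k\cdot\mathbf x}\,d\mathbf x$. For a weight $v:\mathbb Z^m\to[1,\infty)$ the Sobolev type space is $\mathrm H^{v}(\mathbb T^m)=\{g\in \mathrm L_2(\mathbb T^m): \|g\|_{\mathrm H^v}=(\sum_{\mathbf k\in\mathbb Z^m}v(\mathbf k)^2|c_{\mathbf k}(g)|^2)^{1/2}<\infty\}$. For $\mathbf u\subseteq\mathcal D$, $\mathbf u^c=\mathcal D\setminus\mathbf u$, $\mathbf x_{\mathbf u}=(x_i)_{i\in\mathbf u}$, and $\mathbf k_{\mathbf u}$ analogously. The projection is $\mathrm P_{\mathbf u}f(\mathbf x_{\mathbf u})=\int_{\mathbb T^{|\mathbf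 u^c|}}f(\mathbf x)\,d\mathbf x_{\mathbf u^c}$; the ANOVA terms are defined recursively by $f_{\mathbf u}=\mathrm P_{\mathbf u}f-\sum_{\mathbf v\subsetneq\mathbf u}f_{\mathbf v}$; both are regarded as functions on $\mathbb T^{|\mathbf u|}$. Convention $\mathbb Z^{0}=\{0\}$. *)

(* Defs.v *)
From HB Require Import structures.
From mathcomp Require Import all_boot all_order all_algebra.
From mathcomp Require Import all_classical all_reals all_analysis.
From mathcomp Require Import complex.

Set Implicit Arguments.
Unset Strict Implicit.
Unset Printing Implicit Defensive.

Import Order.TTheory GRing.Theory Num.Theory.
Import numFieldNormedType.Exports.
Local Open Scope classical_set_scope.
Local Open Scope ring_scope.

Section Defs.
Variable R : realType.

Fixpoint cube_int (m : nat) : (m.-tuple R -> \bar R) -> \bar R :=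
  match m return (m.-tuple R -> \bar R) -> \bar R with
  | 0 => fun g => g [tuple]
  | m'.+1 => fun g =>
      (\int[@lebesgue_measure R]_(x in `[0%R, 1%R[) cube_int (fun t => g (cons_tuple x t)))%E
  end.

Definition reC (z : R[i]) : R := complex.Re z.
Definition imC (z : R[i]) : R := complex.Im z.

Definition cint (m : nat) (g : m.-tuple R -> R[i]) : R[i] :=
  Complex (fine (cube_int (fun t => (reC (g t))%:E)))
          (fine (cube_int (fun t => (imC (g t))%:E))).

Definition sqmod (z : R[i]) : R := reC z ^+ 2 + imC z ^+ 2.

Definition inL2 (m : nat) (g : m.-tuple R -> R[i]) : Prop :=
  [/\ measurable_fun setT (fun t => reC (g t)),
      measurable_fun setT (fun t => imC (g t)) &
      (cube_int (fun t => (sqmod (g t))%:E) < +oo)%E].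

Definition dotk (m : nat) (k : m.-tuple int) (x : m.-tuple R) : R :=
  \sum_(j < m) (tnth k j)%:~R * tnth x j.

Definition expm2pi (theta : R) : R[i] :=
  Complex (cos (2 * pi * theta)) (- sin (2 * pi * theta)).

Definition fourier (m : nat) (g : m.-tuple R -> R[i]) (k : m.-tuple int) : R[i] :=
  cint (fun x => g x * expm2pi (dotk k x)).

Definition inH (m : nat) (v : m.-tuple int -> R) (g : m.-tuple R -> R[i]) : Prop :=
  inL2 g /\
  (\esum_(k in [set: m.-tuple int]) ((v k) ^+ 2 * sqmod (fourier g k))%:E < +oo)%E.

Definition weight (m : nat) (v : m.-tuple int -> R) : Prop := forall k, 1 <= v k.

Variable d : nat.

Definition restr (T : Type) (u : {set 'I_d}) (x : d.-tuple T) : #|u|.-tuple T :=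
  map_tuple (tnth x) (enum_tuple (mem u)).

Definition merge (u : {set 'I_d}) (y : #|u|.-tuple R) (z : #|~: u|.-tuple R)
  : d.-tuple R :=
  [tuple (if i \in u then nth 0 y (index i (enum u))
          else nth 0 z (index i (enum (~: u)))) | i < d].

Definition Pproj (u : {set 'I_d}) (f : d.-tuple R -> R[i]) : #|u|.-tuple R -> R[i] :=
  fun y => cint (fun z => f (merge y z)).

Definition ANOVA_PT (u : {set 'I_d}) (f : d.-tuple R -> R[i]) : d.-tuple R -> R[i] :=
  fun x => Pproj f (restr u x).

(* ANOVA terms f_u = P_u f - sum_{v proper subset of u} f_v, as functions of the
   full variable x; the fuel n must be >= #|u|. *)
Fixpoint anova_aux (f : d.-tuple R -> R[i]) (n : nat) (u : {set 'I_d})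
  : d.-tuple R -> R[i] :=
  match n with
  | 0 => ANOVA_PT u f
  | n'.+1 => fun x => ANOVA_PT u f x - \sum_(v : {set 'I_d} | v \proper u) anova_aux f n' v x
  end.

Definition anova_term (u : {set 'I_d}) (f : d.-tuple R -> R[i]) : #|u|.-tuple R -> R[i] :=
  fun y => anova_aux f #|u| u (merge y [tuple 0 | _ < #|~: u|]).

End Defs.

Arguments restr {d T} u x.
Arguments merge {R d} u y z.
Arguments Pproj {R d} u f.
Arguments ANOVA_PT {R d} u f.
Arguments anova_term {R d} u f.

(* Main.v *)
(* The iterated integral over the cube is integration against a product
   probability on tuples, and merging coordinates pushes the product of the
   cubes over u and its complement to the full cube. By Jensen's inequality and
   Fubini, P_v f, seen as a function of all variables, is square integrable and
   its Fourier coefficient at k is c_k(f) if k vanishes off v and 0 otherwise.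
   Hence every function obtained from such projections by differences has
   Fourier coefficients bounded by a constant times those of f. If moreover it
   depends on the variables in u only, its coefficient at a frequency k on u is
   the one at the extension of k by zero, so that wu <= w on these frequencies
   gives membership in H^wu. *)

Require Import Defs.
From HB Require Import structures.
From mathcomp Require Import all_boot all_order all_algebra.
From mathcomp Require Import all_classical all_reals all_analysis.
From mathcomp Require Import measurable_realfun ring lra.
From mathcomp Require Import complex.

Set Implicit Arguments.
Unset Strict Implicit.
Unset Printing Implicit Defensive.

Import Order.TTheory GRing.Theory Num.Theory.
Local Open Scope ring_scope.

Local Notation merge := Defs.merge.

(** * The iterated integral as an integral against a product probability *)

Section CubeMeasure.
Context {R : realType}.
Local Open Scope ereal_scope.

Let measurable_id_R :
  measurable_fun setT (idfun : measurableTypeR R -> R).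
Proof. exact: measurable_id. Qed.

(* [lebesgue_measure] lives on [measurableTypeR R], a copy of [R]. *)
Definition unit_prob : probability R R :=
  @distribution _ _ _ R _ (uniform_prob (@ltr01 R))
    (MeasurableFun.Pack (MeasurableFun.Class
      (isMeasurableFun.Build _ _ _ _ _ measurable_id_R))).

Local Notation U := unit_prob.

(** The uniform density is [1] and the endpoint [1] is a null set, which settles nonnegative
    functions. Both integrals split as positive part minus negative part, so measurability alone is
    enough. *)
Lemma integral_unit_interval (g : R -> \bar R) : measurable_fun setT g ->
  \int[@lebesgue_measure R]_(x in `[0%R, 1%R[) g x = \int[U]_x g x.
Proof.
move=> mg.
have ge0 (h : R -> \bar R) : measurable_fun setT h -> (forall x, 0 <= h x) ->
    \int[@lebesgue_measure R]_(x in `[0%R, 1%R[) h x = \int[U]_x h x.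
  move=> mh h0; rewrite ge0_integral_distribution// integral_uniform//=.
  rewrite subr0 invr1 mul1e.
  by rewrite integral_itv_bndo_bndc//; exact: measurable_funS mh.
rewrite [LHS]integralE [RHS]integralE !ge0//.
- exact: measurable_funeneg.
- exact: measurable_funepos.
Qed.

(** The parameter space [T] is arbitrary because the induction on [m] moves the first coordinate
    into it, passing from [T] to [T * R]. Tonelli is applied to the positive and negative parts
    separately, so that no integrability is asked for. *)
Lemma measurable_cube_int d (T : measurableType d) m
    (F : T -> m.-tuple R -> \bar R) :
  measurable_fun [set: T * m.-tuple R] (fun p => F p.1 p.2) ->
  measurable_fun [set: T] (fun y => cube_int (F y)).
Proof.
elim: m d T F => [|m IH] d T F mF /=.
  rewrite (_ : (fun y => _) =
    (fun p => F p.1 p.2) \o (fun y => (y, [tuple])))//.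
  by apply: measurableT_comp => //; exact: measurable_pair1.
pose H (p : T * R) := cube_int (fun t => F p.1 (cons_tuple p.2 t)).
have mH : measurable_fun setT H.
  apply: (IH _ (T * R)%type (fun p t => F p.1 (cons_tuple p.2 t))).
  rewrite (_ : (fun p => _) = (fun p => F p.1 p.2) \o
    (fun p : (T * R) * m.-tuple R => (p.1.1, cons_tuple p.1.2 p.2)))//.
  apply: measurableT_comp => //; apply: measurable_fun_pair => /=.
    exact: measurableT_comp.
  by apply: measurable_cons => //; exact: measurableT_comp.
rewrite (_ : (fun y => _) = (fun y => \int[U]_x H^\+ (y, x)) \-
    (fun y => \int[U]_x H^\- (y, x))); last first.
  apply/funext => y; rewrite integral_unit_interval.
    by rewrite integralE; congr (_ - _); apply: eq_integral => x _;
      rewrite ?funeposE ?funenegE.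
  exact: (measurableT_comp mH (measurable_pair1 y)).
apply: emeasurable_funB.
- apply: (@measurable_fun_fubini_tonelli_F _ _ _ _ _ U H^\+) => //.
  exact: measurable_funepos.
- apply: (@measurable_fun_fubini_tonelli_F _ _ _ _ _ U H^\-) => //.
  exact: measurable_funeneg.
Qed.

Let consp m (p : R * m.-tuple R) : m.+1.-tuple R := cons_tuple p.1 p.2.

Let measurable_consp m : measurable_fun setT (@consp m).
Proof. exact: measurable_cons. Qed.

HB.instance Definition _ m :=
  isMeasurableFun.Build _ _ _ _ _ (@measurable_consp m).

(** The pushforward of the binary product under [cons] follows the recursion of [cube_int], so that
    each induction step below is one use of Tonelli or Fubini. *)
Fixpoint cube_prob m : probability (m.-tuple R) R :=
  match m with
  | 0 => dirac ([tuple] : 0.-tuple R)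
  | m'.+1 => distribution (U \x cube_prob m') (@consp m')
  end.

Lemma cube_int_ge0E m (g : m.-tuple R -> \bar R) :
  measurable_fun setT g -> (forall t, 0 <= g t) ->
  cube_int g = \int[cube_prob m]_t g t.
Proof.
elim: m g => [|m IH] g mg g0 /=.
  by rewrite integral_dirac//= diracT mul1e.
have mgc : measurable_fun setT (g \o @consp m) by exact: measurableT_comp.
rewrite ge0_integral_distribution// fubini_tonelli1//; last first.
  by move=> x /=.
rewrite integral_unit_interval; last first.
  apply: (@measurable_cube_int _ _ _ (fun x t => g (cons_tuple x t))).
  exact: mgc.
apply: eq_integral => x _; rewrite IH//.
exact: (measurableT_comp mgc (measurable_pair1 x)).
Qed.

(** By Fubini only almost every slice of [g] is integrable, so the induction hypothesis identifies
    the inner integrals almost everywhere. This suffices for the outer integral, both inner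
    integrals being measurable in [x]. *)
Lemma cube_int_integrableE m (g : m.-tuple R -> \bar R) :
  (cube_prob m).-integrable setT g ->
  cube_int g = \int[cube_prob m]_t g t.
Proof.
elim: m g => [|m IH] g ig; have mg := measurable_int _ ig => /=.
  by rewrite integral_dirac//= diracT mul1e.
have mgc : measurable_fun setT (g \o @consp m) by exact: measurableT_comp.
have igc : (U \x cube_prob m).-integrable setT (g \o @consp m).
  apply/integrableP; split => //.
  move/integrableP : ig => [_] /=; rewrite ge0_integral_distribution//.
  exact: measurableT_comp.
rewrite integral_distribution// -(integral12_prod_meas1 igc).
have mc : measurable_fun setT (fun x => cube_int (fun t => g (cons_tuple x t))).
  exact: (@measurable_cube_int _ _ _ (fun x t => g (cons_tuple x t))).
rewrite integral_unit_interval//.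
apply: ae_eq_integral => //; first exact: (measurable_fubini_F igc).
have := ae_integrable1 igc; apply: filterS => x ix _.
exact: IH.
Qed.

End CubeMeasure.

(** * Restricting and merging tuples of coordinates *)

Section Merge.
Context {R : realType} {d : nat}.
Implicit Type u : {set 'I_d}.

Lemma tnth_restr (T : Type) u (x : d.-tuple T) (j : 'I_#|u|) :
  tnth (restr u x) j = tnth x (enum_val j).
Proof. by rewrite tnth_map (tnth_nth (enum_val j)) -enum_val_nth. Qed.

Lemma index_enum_val u (j : 'I_#|u|) : index (enum_val j) (enum u) = j.
Proof.
by rewrite (enum_val_nth (enum_val j)) index_uniq ?enum_uniq -?cardE.
Qed.

Lemma tnth_merge_in u (y : #|u|.-tuple R) (z : #|~: u|.-tuple R) (j : 'I_#|u|) :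
  tnth (merge u y z) (enum_val j) = tnth y j.
Proof. by rewrite tnth_mktuple enum_valP index_enum_val (tnth_nth 0). Qed.

Lemma tnth_merge_out u (y : #|u|.-tuple R) (z : #|~: u|.-tuple R)
    (j : 'I_#|~: u|) :
  tnth (merge u y z) (enum_val j) = tnth z j.
Proof.
rewrite tnth_mktuple; have := enum_valP j; rewrite inE => /negPf ->.
by rewrite index_enum_val (tnth_nth 0).
Qed.

(** A case view that presents an index through its position in [u] or in the complement, the form in
    which [tnth_merge_in] and [tnth_merge_out] rewrite. *)
Variant in_or_out u (i : 'I_d) : bool -> Prop :=
| InSet (j : 'I_#|u|) of i = enum_val j : in_or_out u i true
| OutSet (j : 'I_#|~: u|) of i = enum_val j : in_or_out u i false.

Lemma in_or_outP u (i : 'I_d) : in_or_out u i (i \in u).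
Proof.
case: (boolP (i \in u)) => iu.
  by apply: (@InSet u i (enum_rank_in iu i)); rewrite enum_rankK_in.
have iu' : i \in ~: u by rewrite inE.
by apply: (@OutSet u i (enum_rank_in iu' i)); rewrite enum_rankK_in.
Qed.

Lemma restr_merge u (y : #|u|.-tuple R) (z : #|~: u|.-tuple R) :
  restr u (merge u y z) = y.
Proof. by apply: eq_from_tnth => j; rewrite tnth_restr tnth_merge_in. Qed.

Lemma restr_merge_sub u (v : {set 'I_d}) (y : #|u|.-tuple R)
    (z z' : #|~: u|.-tuple R) : v \subset u ->
  restr v (merge u y z) = restr v (merge u y z').
Proof.
move=> /fintype.subsetP vu; apply: eq_from_tnth => j; rewrite !tnth_restr.
have := vu _ (enum_valP j); case: (in_or_outP u (enum_val j)) => // i -> _.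
by rewrite !tnth_merge_in.
Qed.

Lemma measurable_restr u :
  measurable_fun [set: d.-tuple R] (fun x => restr u x).
Proof.
apply/measurable_fun_tnthP => j.
rewrite (_ : _ \o _ = fun x : d.-tuple R => tnth x (enum_val j)).
  exact: measurable_tnth.
by apply/funext => x; exact: tnth_restr.
Qed.

Lemma measurable_merge u :
  measurable_fun [set: #|u|.-tuple R * #|~: u|.-tuple R]
    (fun p => merge u p.1 p.2).
Proof.
apply/measurable_fun_tnthP => i; case: (in_or_outP u i) => j ->.
  rewrite (_ : _ \o _ = (fun t => tnth t j) \o fst); last first.
    by apply/funext => p; exact: tnth_merge_in.
  by apply: measurableT_comp => //; exact: measurable_tnth.
rewrite (_ : _ \o _ = (fun t => tnth t j) \o snd); last first.
  by apply/funext => p; exact: tnth_merge_out.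
by apply: measurableT_comp => //; exact: measurable_tnth.
Qed.

Lemma measurable_merge_snd u (y : #|u|.-tuple R) :
  measurable_fun [set: #|~: u|.-tuple R] (merge u y).
Proof.
apply/measurable_fun_tnthP => i; case: (in_or_outP u i) => j ->.
  rewrite (_ : _ \o _ = cst (tnth y j)); first exact: measurable_cst.
  by apply/funext => z; exact: tnth_merge_in.
rewrite (_ : _ \o _ = fun t => tnth t j); first exact: measurable_tnth.
by apply/funext => z; exact: tnth_merge_out.
Qed.

Lemma measurable_merge_fst u (z : #|~: u|.-tuple R) :
  measurable_fun [set: #|u|.-tuple R] (fun y => merge u y z).
Proof.
apply/measurable_fun_tnthP => i; case: (in_or_outP u i) => j ->.
  rewrite (_ : _ \o _ = fun t => tnth t j); first exact: measurable_tnth.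
  by apply/funext => y; exact: tnth_merge_in.
rewrite (_ : _ \o _ = cst (tnth z j)); first exact: measurable_cst.
by apply/funext => y; exact: tnth_merge_out.
Qed.

End Merge.

(** * The cube probability factors over [u] and its complement *)

Section CubeProbMerge.
Context {R : realType}.
Local Open Scope classical_set_scope.
Local Open Scope ereal_scope.

Definition box m (A : 'I_m -> set R) : set (m.-tuple R) :=
  [set t | forall i, A i (tnth t i)].

Lemma measurable_box m (A : 'I_m -> set R) :
  (forall i, measurable (A i)) -> measurable (box A).
Proof.
move=> mA.
rewrite (_ : box A = \big[setI/setT]_(i < m) ((fun t => tnth t i) @^-1` A i)).
  apply: bigsetI_measurable => i _; rewrite -[X in measurable X]setTI.
  exact: measurable_tnth.
rewrite -bigcap_seq; apply/seteqP; split => [t At i _|t At i]; first exact: At.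
by apply: At => /=; rewrite mem_index_enum.
Qed.

Lemma cube_prob_box m (A : 'I_m -> set R) : (forall i, measurable (A i)) ->
  cube_prob m (box A) = \prod_(i < m) unit_prob (A i).
Proof.
elim: m A => [|m IH] A mA.
  rewrite big_ord0 /= diracE mem_set// => -[]//.
transitivity ((unit_prob \x cube_prob m)
    (A ord0 `*` box (fun i => A (lift ord0 i)))); last first.
  by rewrite big_ord_recl -IH// product_measure1E//; exact: measurable_box.
rewrite (_ : _ `*` _ =
  (fun p : R * m.-tuple R => cons_tuple p.1 p.2) @^-1` box A)//.
apply/seteqP; split=> [[x t] /= [A0 At] i|[x t] /= At]; last first.
  split; first exact: (At ord0).
  by move=> i /=; have := At (lift ord0 i); rewrite tnthS.
by case: (unliftP ord0 i) => [j ->|->//]; rewrite tnthS.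
Qed.

(** Measurable boxes are stable under intersection and generate the sigma-algebra of tuples, so the
    uniqueness theorem for finite measures applies. *)
Lemma cube_prob_unique m (mu : {measure set (m.-tuple R) -> \bar R}) :
  (forall A : 'I_m -> set R, (forall i, measurable (A i)) ->
     mu (box A) = \prod_(i < m) unit_prob (A i)) ->
  forall B, measurable B -> mu B = cube_prob m B.
Proof.
move=> muE B mB.
pose G := [set C | exists2 A : 'I_m -> set R,
                     (forall i, measurable (A i)) & C = box A].
have GT : G setT by exists (fun=> setT) => //; apply/seteqP; split.
apply: (measure_unique G (fun=> setT)) => //.
- apply/seteqP; split; apply: smallest_sub; last first.
  + by move=> _ [A mA ->]; exact: measurable_box.
  + exact: sigma_algebra_measurable.
  + rewrite -bigcup_seq => _ [i _ [A mA <-]]; apply: sub_sigma_algebra.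
    (* A generator of the sigma-algebra constrains the coordinate [i] alone: it is the box whose
       other sides are full. *)
    exists (fun j => if j == i then A else setT) => [j|]; first by case: ifP.
    rewrite setTI; apply/seteqP; split => [t /= At j|t /= /(_ i)].
      by case: eqP => // ->.
    by rewrite eqxx.
  + exact: smallest_sigma_algebra.
- move=> _ _ [A mA ->] [A' mA' ->]; exists (fun i => A i `&` A' i).
    by move=> i; exact: measurableI.
  apply/seteqP; split => [t [At A't] i|t At]; first by split.
  by split => i; case: (At i).
- by rewrite bigcup_const.
- by move=> _ [A mA ->]; rewrite muE//; exact/esym/cube_prob_box.
- move=> _; rewrite (_ : setT = box (fun=> setT)) ?muE//.
    by rewrite big1 ?ltry// => i _; rewrite probability_setT.
  by apply/seteqP; split.
Qed.

Context {d : nat}.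
Variable u : {set 'I_d}.

Definition merge_pair (p : #|u|.-tuple R * #|~: u|.-tuple R) : d.-tuple R :=
  merge u p.1 p.2.

HB.instance Definition _ :=
  isMeasurableFun.Build _ _ _ _ merge_pair (@measurable_merge R d u).

(** By uniqueness it is enough to test boxes. The preimage of a box under merging is a product of
    two boxes, and the product of the side measures splits accordingly into indices in [u] and
    indices outside [u]. *)
Lemma cube_prob_merge (B : set (d.-tuple R)) : measurable B ->
  distribution (cube_prob #|u| \x cube_prob #|~: u|) merge_pair B =
  cube_prob d B.
Proof.
apply: cube_prob_unique => A mA.
transitivity ((cube_prob #|u| \x cube_prob #|~: u|)
    (box (fun j : 'I_#|u| => A (enum_val j)) `*`
     box (fun j : 'I_#|~: u| => A (enum_val j)))).
  rewrite (_ : _ `*` _ = merge_pair @^-1` box A)//.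
  apply/seteqP; split => [[y z] /= [Ay Az] i|[y z] /= Ap].
    rewrite /merge_pair/=.
    by case: (in_or_outP u i) => j ->; rewrite (tnth_merge_in,tnth_merge_out).
  split => j; have := Ap (enum_val j).
    by rewrite tnth_merge_in.
  by rewrite tnth_merge_out.
rewrite product_measure1E//; [|exact: measurable_box..].
transitivity ((\prod_(j < #|u|) unit_prob (A (enum_val j))) *
    (\prod_(j < #|~: u|) unit_prob (A (enum_val j)))).
  by congr (_ * _); exact: cube_prob_box.
rewrite -!(big_enum_val (fun i => unit_prob (A i))) [RHS](bigID (mem u))/=.
by congr (_ * _); apply: eq_bigl => i; rewrite inE.
Qed.

End CubeProbMerge.

(** * Tonelli and Fubini for the iterated integral *)

Section CubeIntMerge.
Context {R : realType} {d : nat}.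
Variable u : {set 'I_d}.
Local Open Scope ereal_scope.

Let mcomp d' (T : measurableType d') (g : d.-tuple R -> T) :
  measurable_fun setT g ->
  measurable_fun [set: #|u|.-tuple R * #|~: u|.-tuple R]
    (g \o @merge_pair R d u).
Proof. by move=> mg; apply: measurableT_comp. Qed.

Let integral_cube_prob_merge (g : d.-tuple R -> \bar R) :
  \int[cube_prob d]_x g x =
  \int[distribution (cube_prob #|u| \x cube_prob #|~: u|)
         (@merge_pair R d u)]_x g x.
Proof.
by apply: eq_measure_integral => B mB _; exact/esym/cube_prob_merge.
Qed.

Lemma measurable_cube_int_merge (g : d.-tuple R -> \bar R) :
  measurable_fun setT g ->
  measurable_fun setT (fun y => cube_int (fun z => g (merge u y z))).
Proof.
move=> mg; apply: (measurable_cube_int (F := fun y z => g (merge u y z))).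
exact: mcomp.
Qed.

Lemma cube_int_merge_ge0 (g : d.-tuple R -> \bar R) :
  measurable_fun setT g -> (forall x, 0 <= g x) ->
  cube_int g = cube_int (fun y => cube_int (fun z => g (merge u y z))).
Proof.
move=> mg g0; rewrite cube_int_ge0E//.
rewrite integral_cube_prob_merge.
rewrite ge0_integral_distribution// fubini_tonelli1;
  [|exact: mcomp|by move=> p; exact: g0].
have slice y : cube_int (fun z => g (merge u y z)) =
    \int[cube_prob #|~: u|]_z g (merge u y z).
  rewrite cube_int_ge0E//.
  exact: (measurableT_comp mg (measurable_merge_snd y)).
rewrite cube_int_ge0E//; last 2 first.
- exact: measurable_cube_int_merge.
- by move=> y; rewrite slice; exact: integral_ge0.
by apply: eq_integral => y _; rewrite slice.
Qed.

Section integrable_merge.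
Variable g : d.-tuple R -> \bar R.
Hypothesis ig : (cube_prob d).-integrable setT g.

Let mg : measurable_fun setT g. Proof. exact: measurable_int ig. Qed.

Let ig2 : (cube_prob #|u| \x cube_prob #|~: u|).-integrable setT
  (g \o @merge_pair R d u).
Proof.
apply/integrableP; split; first exact: measurableT_comp.
move/integrableP : (ig) => [_].
rewrite integral_cube_prob_merge.
by rewrite ge0_integral_distribution//; exact: measurableT_comp.
Qed.

Lemma ae_integrable_merge : {ae cube_prob #|u|, forall y,
  (cube_prob #|~: u|).-integrable setT (fun z => g (merge u y z))}.
Proof. exact: ae_integrable1 ig2. Qed.

Let ae_slice : ae_eq (cube_prob #|u|) setT
  (fubini_F (cube_prob #|~: u|) (g \o @merge_pair R d u))
  (fun y => cube_int (fun z => g (merge u y z))).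
Proof.
by apply: filterS ae_integrable_merge => y iy _; rewrite cube_int_integrableE.
Qed.

(** On slices that are not integrable, [cube_int] need not agree with the integral against
    [cube_prob]. These slices form a null set, so integrability is carried over from the inner
    integral of Fubini's theorem by almost everywhere equality. *)
Lemma integrable_cube_int_merge :
  (cube_prob #|u|).-integrable setT
    (fun y => cube_int (fun z => g (merge u y z))).
Proof.
have mc := measurable_cube_int_merge mg.
apply/integrableP; split => //.
have /integrableP[mF] := integrable_fubini_F ig2; apply: le_lt_trans.
rewrite le_eqVlt; apply/orP; left; apply/eqP; apply: ae_eq_integral => //.
- exact: measurableT_comp.
- exact: measurableT_comp.
- by apply: filterS ae_slice => y /[apply] ->.
Qed.

Lemma cube_int_merge :
  cube_int g = cube_int (fun y => cube_int (fun z => g (merge u y z))).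
Proof.
rewrite !cube_int_integrableE//; last exact: integrable_cube_int_merge.
rewrite integral_cube_prob_merge.
rewrite integral_distribution// -(integral12_prod_meas1 ig2).
apply: ae_eq_integral => //.
- exact: measurable_fubini_F ig2.
- exact: measurable_cube_int_merge.
Qed.

End integrable_merge.

End CubeIntMerge.

(** * Calculus of the real-valued integral *)

Section RealIntegral.
Context {R : realType}.

(** The real and imaginary parts of [cint] are of this form by definition. Since [fine] sends
    infinite values to [0], the algebraic rules below are stated for integrable functions. *)
Definition rint m (r : m.-tuple R -> R) : R := fine (cube_int (EFin \o r)).

Definition rintegrable m (r : m.-tuple R -> R) : Prop :=
  (cube_prob m).-integrable setT (EFin \o r).

Lemma rint_Rintegral m (r : m.-tuple R -> R) : rintegrable r ->
  rint r = \int[cube_prob m]_x r x.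
Proof. by move=> ir; rewrite /rint cube_int_integrableE. Qed.

Lemma cube_int_rint m (r : m.-tuple R -> R) : rintegrable r ->
  cube_int (EFin \o r) = (rint r)%:E.
Proof.
move=> ir; rewrite /rint fineK// cube_int_integrableE//.
exact: integrable_fin_num.
Qed.

Lemma measurable_rintegrable m (r : m.-tuple R -> R) : rintegrable r ->
  measurable_fun setT r.
Proof.
rewrite /rintegrable => ir; apply/measurable_EFinP; exact: measurable_int ir.
Qed.

Lemma rintegrable_cst m c : rintegrable (fun _ : m.-tuple R => c).
Proof. exact: finite_measure_integrable_cst. Qed.

Lemma rint_cst m c : rint (fun _ : m.-tuple R => c) = c.
Proof.
rewrite rint_Rintegral; last exact: rintegrable_cst.
transitivity (c * fine (cube_prob m [set: m.-tuple R]%classic)).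
  exact: Rintegral_cst.
by rewrite probability_setT/= mulr1.
Qed.

Lemma rintegrableZ m c (r : m.-tuple R -> R) : rintegrable r ->
  rintegrable (fun x => c * r x).
Proof.
move=> ir; rewrite /rintegrable.
rewrite (_ : EFin \o _ = (fun x => c%:E * (EFin \o r) x)%E)//.
exact: integrableZl.
Qed.

Lemma rintZ m c (r : m.-tuple R -> R) : rintegrable r ->
  rint (fun x => c * r x) = c * rint r.
Proof.
move=> ir; rewrite !rint_Rintegral//; last exact: rintegrableZ.
exact: RintegralZl.
Qed.

Lemma rintegrableD m (r s : m.-tuple R -> R) : rintegrable r ->
  rintegrable s -> rintegrable (fun x => r x + s x).
Proof. by move=> ir js; exact: (integrableD measurableT ir js). Qed.

Lemma rintD m (r s : m.-tuple R -> R) : rintegrable r -> rintegrable s ->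
  rint (fun x => r x + s x) = rint r + rint s.
Proof.
move=> ir js; rewrite !rint_Rintegral//; last exact: rintegrableD.
exact: RintegralD.
Qed.

Lemma rintegrableB m (r s : m.-tuple R -> R) : rintegrable r ->
  rintegrable s -> rintegrable (fun x => r x - s x).
Proof. by move=> ir js; exact: (integrableB measurableT ir js). Qed.

Lemma rintB m (r s : m.-tuple R -> R) : rintegrable r -> rintegrable s ->
  rint (fun x => r x - s x) = rint r - rint s.
Proof.
move=> ir js; rewrite !rint_Rintegral//; last exact: rintegrableB.
exact: RintegralB.
Qed.

Lemma rint_ge0 m (r : m.-tuple R -> R) : rintegrable r ->
  (forall x, 0 <= r x) -> 0 <= rint r.
Proof. by move=> ir r0; rewrite rint_Rintegral//; exact: Rintegral_ge0. Qed.

Lemma ae_rint m (r s : m.-tuple R -> R) : rintegrable r ->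
  measurable_fun setT s -> {ae cube_prob m, forall x, r x = s x} ->
  rintegrable s /\ rint s = rint r.
Proof.
move=> ir ms rs; have mr := measurable_rintegrable ir.
have is_ : rintegrable s.
  apply/integrableP; split; first exact/measurable_EFinP.
  move/integrableP : ir => [_]; apply: le_lt_trans.
  rewrite le_eqVlt; apply/orP; left; apply/eqP; apply: ae_eq_integral => //.
  - by apply: measurableT_comp => //; exact/measurable_EFinP.
  - by apply: measurableT_comp => //; exact/measurable_EFinP.
  - by apply: filterS rs => x /= ->.
split => //; rewrite !rint_Rintegral//; congr fine.
apply: ae_eq_integral => //; [exact/measurable_EFinP..|].
by apply: filterS rs => x /= ->.
Qed.

Lemma rintegrable_merge d (u : {set 'I_d}) (r : d.-tuple R -> R) :
  rintegrable r -> {ae cube_prob #|u|, forall y : #|u|.-tuple R,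
    rintegrable (fun z => r (merge u y z))}.
Proof. by move=> ir; exact: ae_integrable_merge ir. Qed.

Lemma measurable_rint_merge d (u : {set 'I_d}) (r : d.-tuple R -> R) :
  measurable_fun setT r ->
  measurable_fun setT (fun y => rint (fun z => r (merge u y z))).
Proof.
move=> mr; have mE : measurable_fun setT (EFin \o r) by exact/measurable_EFinP.
apply: (@measurableT_comp _ _ _ _ _ _ fine) => //.
exact: measurable_cube_int_merge mE.
Qed.

(** Truncating the inner integral by [fine] changes it at most on the null set of non-integrable
    slices; the claims thus follow from Fubini for [cube_int]. *)
Lemma rint_merge d (u : {set 'I_d}) (r : d.-tuple R -> R) : rintegrable r ->
  rintegrable (fun y => rint (fun z => r (merge u y z))) /\
  rint r = rint (fun y => rint (fun z => r (merge u y z))).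
Proof.
move=> ir; have mr := measurable_rintegrable ir.
have ms : measurable_fun setT
    (EFin \o (fun y => rint (fun z => r (merge u y z)))).
  by apply/measurable_EFinP; exact: measurable_rint_merge.
have ic := integrable_cube_int_merge u ir.
have ae : ae_eq (cube_prob #|u|) setT
    (fun y => cube_int (fun z => (r (merge u y z))%:E))
    (EFin \o (fun y => rint (fun z => r (merge u y z)))).
  apply: filterS (rintegrable_merge u ir) => y iy _ /=.
  exact: (cube_int_rint iy).
have is_ : rintegrable (fun y => rint (fun z => r (merge u y z))).
  apply/integrableP; split => //.
  move/integrableP : (ic) => [mc]; apply: le_lt_trans.
  rewrite le_eqVlt; apply/orP; left; apply/eqP; apply: ae_eq_integral => //.
  - exact: measurableT_comp.
  - exact: measurableT_comp.
  - by apply: filterS ae => x /[apply] /= ->.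
split => //; rewrite {1}/rint (cube_int_merge u ir) rint_Rintegral//.
rewrite cube_int_integrableE//; congr fine.
by apply: ae_eq_integral => //; exact: measurable_int ic.
Qed.

(* Jensen's inequality, from [0 <= rint (r - rint r)^2]. *)
Lemma rint_sqr m (r : m.-tuple R -> R) : rintegrable r ->
  rintegrable (fun x => r x ^+ 2) -> rint r ^+ 2 <= rint (fun x => r x ^+ 2).
Proof.
move=> ir ir2; pose c := rint r.
have i1 : rintegrable (fun x => 2 * c * r x) by exact: rintegrableZ.
have i2 := rintegrableB ir2 i1.
have i3 := rintegrableD i2 (rintegrable_cst m (c ^+ 2)).
have : 0 <= rint (fun x => r x ^+ 2 - 2 * c * r x + c ^+ 2).
  apply: rint_ge0 => // x.
  by rewrite (_ : _ + _ = (r x - c) ^+ 2) ?sqr_ge0// sqrrB; ring.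
rewrite rintD//; last exact: rintegrable_cst.
rewrite rintB// rintZ// rint_cst -/c => H; nra.
Qed.

End RealIntegral.

(** * Calculus of the complex-valued integral *)

Section ComplexIntegral.
Context {R : realType}.
Implicit Types a b c : R[i].

Lemma reCM a b : reC (a * b) = reC a * reC b - imC a * imC b.
Proof. by case: a b => [? ?] []. Qed.

Lemma imCM a b : imC (a * b) = reC a * imC b + imC a * reC b.
Proof. by case: a b => [? ?] []. Qed.

Lemma reCB a b : reC (a - b) = reC a - reC b.
Proof. by case: a b => [? ?] []. Qed.

Lemma imCB a b : imC (a - b) = imC a - imC b.
Proof. by case: a b => [? ?] []. Qed.

Lemma eq_reC_imC a b : reC a = reC b -> imC a = imC b -> a = b.
Proof. by case: a b => [? ?] [? ?] /= -> ->. Qed.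

Lemma sqmodM a b : sqmod (a * b) = sqmod a * sqmod b.
Proof. by rewrite /sqmod reCM imCM; ring. Qed.

Lemma sqmod_ge0 a : 0 <= sqmod a.
Proof. by rewrite addr_ge0// sqr_ge0. Qed.

(** Parallelogram law: the right side minus the left side is [sqmod (a + b)]. *)
Lemma sqmodB_le a b : sqmod (a - b) <= 2 * sqmod a + 2 * sqmod b.
Proof.
rewrite /sqmod reCB imCB.
have := sqr_ge0 (reC a + reC b); have := sqr_ge0 (imC a + imC b); nra.
Qed.

Lemma reC_cint m (g : m.-tuple R -> R[i]) :
  reC (cint g) = rint (fun t => reC (g t)).
Proof. by []. Qed.

Lemma imC_cint m (g : m.-tuple R -> R[i]) :
  imC (cint g) = rint (fun t => imC (g t)).
Proof. by []. Qed.

Lemma normr_reC_le a : `|reC a| <= 1 + sqmod a.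
Proof.
rewrite /sqmod ler_norml.
by have := sqr_ge0 (reC a); have := sqr_ge0 (imC a); nra.
Qed.

Lemma normr_imC_le a : `|imC a| <= 1 + sqmod a.
Proof.
rewrite /sqmod ler_norml.
by have := sqr_ge0 (reC a); have := sqr_ge0 (imC a); nra.
Qed.

Definition cmeasurable m (g : m.-tuple R -> R[i]) : Prop :=
  measurable_fun setT (fun t => reC (g t)) /\
  measurable_fun setT (fun t => imC (g t)).

Definition cintegrable m (g : m.-tuple R -> R[i]) : Prop :=
  rintegrable (fun t => reC (g t)) /\ rintegrable (fun t => imC (g t)).

Lemma cmeasurableM m (g h : m.-tuple R -> R[i]) :
  cmeasurable g -> cmeasurable h -> cmeasurable (fun t => g t * h t).
Proof.
move=> [rg ig] [rh ih]; split.
  under eq_fun do rewrite reCM.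
  by apply: measurable_funB; apply: measurable_funM.
under eq_fun do rewrite imCM.
by apply: measurable_funD; apply: measurable_funM.
Qed.

Lemma cmeasurableB m (g h : m.-tuple R -> R[i]) :
  cmeasurable g -> cmeasurable h -> cmeasurable (fun t => g t - h t).
Proof.
move=> [rg ig] [rh ih]; split.
  by under eq_fun do rewrite reCB; exact: measurable_funB.
by under eq_fun do rewrite imCB; exact: measurable_funB.
Qed.

Lemma measurable_sqmod m (g : m.-tuple R -> R[i]) : cmeasurable g ->
  measurable_fun setT (fun t => sqmod (g t)).
Proof. by move=> [rg ig]; apply: measurable_funD; exact: measurable_funX. Qed.

Lemma cintegrableZ m c (g : m.-tuple R -> R[i]) : cintegrable g ->
  cintegrable (fun t => c * g t).
Proof.
move=> [rg ig]; split.
  under [X in rintegrable X]eq_fun do rewrite reCM.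
  by apply: rintegrableB; exact: rintegrableZ.
under [X in rintegrable X]eq_fun do rewrite imCM.
by apply: rintegrableD; exact: rintegrableZ.
Qed.

Lemma cintZ m c (g : m.-tuple R -> R[i]) : cintegrable g ->
  cint (fun t => c * g t) = c * cint g.
Proof.
move=> [rg ig]; apply: eq_reC_imC; rewrite ?reCM ?imCM.
  transitivity (rint (fun t => reC c * reC (g t) - imC c * imC (g t))).
    by congr rint; apply/funext => t; rewrite reCM.
  by rewrite rintB ?rintZ//; exact: rintegrableZ.
transitivity (rint (fun t => reC c * imC (g t) + imC c * reC (g t))).
  by congr rint; apply/funext => t; rewrite imCM.
by rewrite rintD ?rintZ//; exact: rintegrableZ.
Qed.

Lemma cintB m (g h : m.-tuple R -> R[i]) : cintegrable g -> cintegrable h ->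
  cint (fun t => g t - h t) = cint g - cint h.
Proof.
move=> [rg ig] [rh ih]; apply: eq_reC_imC; rewrite ?reCB ?imCB.
  transitivity (rint (fun t => reC (g t) - reC (h t))); last exact: rintB.
  by congr rint; apply/funext => t; rewrite reCB.
transitivity (rint (fun t => imC (g t) - imC (h t))); last exact: rintB.
by congr rint; apply/funext => t; rewrite imCB.
Qed.

Lemma ae_cint m (g h : m.-tuple R -> R[i]) : cintegrable g -> cmeasurable h ->
  {ae cube_prob m, forall x, g x = h x} -> cint h = cint g.
Proof.
move=> [rg ig] [rh ih] gh; apply: eq_reC_imC.
  have rgh : {ae cube_prob m, forall x, reC (g x) = reC (h x)}.
    by apply: filterS gh => x /= ->.
  by have [] := ae_rint rg rh rgh.
have igh : {ae cube_prob m, forall x, imC (g x) = imC (h x)}.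
  by apply: filterS gh => x /= ->.
by have [] := ae_rint ig ih igh.
Qed.

Section merge.
Context {d : nat}.
Variable u : {set 'I_d}.

Lemma cmeasurable_cint_merge (g : d.-tuple R -> R[i]) : cmeasurable g ->
  cmeasurable (fun y => cint (fun z => g (merge u y z))).
Proof.
move=> [rg ig]; split.
  exact (@measurable_rint_merge R d u (fun t => reC (g t)) rg).
exact (@measurable_rint_merge R d u (fun t => imC (g t)) ig).
Qed.

Lemma cintegrable_merge (g : d.-tuple R -> R[i]) : cintegrable g ->
  {ae cube_prob #|u|, forall y : #|u|.-tuple R,
    cintegrable (fun z => g (merge u y z))}.
Proof.
move=> [rg ig].
apply: filterS (filterI (rintegrable_merge u rg) (rintegrable_merge u ig)).
by move=> y [].
Qed.

Lemma cint_merge (g : d.-tuple R -> R[i]) : cintegrable g ->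
  cintegrable (fun y => cint (fun z => g (merge u y z))) /\
  cint g = cint (fun y => cint (fun z => g (merge u y z))).
Proof.
move=> [rg ig].
have [rg' rE] := rint_merge u rg; have [ig' iE] := rint_merge u ig.
by split => //; exact: eq_reC_imC.
Qed.

End merge.

End ComplexIntegral.

(** * Square integrable functions and Jensen's inequality *)

Section SquareIntegrable.
Context {R : realType}.

Lemma le_cube_int m (g h : m.-tuple R -> \bar R) :
  measurable_fun setT g -> measurable_fun setT h ->
  (forall t, 0 <= g t)%E -> (forall t, g t <= h t)%E ->
  (cube_int g <= cube_int h)%E.
Proof.
move=> mg mh g0 gh; rewrite !cube_int_ge0E//; first exact: ge0_le_integral.
by move=> t; exact: le_trans (gh t).
Qed.

Lemma inL2P m (g : m.-tuple R -> R[i]) :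
  inL2 g <-> cmeasurable g /\ rintegrable (fun t => sqmod (g t)).
Proof.
have cubeE : cmeasurable g -> (cube_int (fun t => (sqmod (g t))%:E) =
    \int[cube_prob m]_t `|(sqmod (g t))%:E|)%E.
  move=> mg; rewrite cube_int_ge0E => [|//|t]; last first.
  - by rewrite lee_fin sqmod_ge0.
  - by apply/measurable_EFinP; exact: measurable_sqmod.
  by apply: eq_integral => t _; rewrite gee0_abs// lee_fin sqmod_ge0.
split=> [[mr mi fin]|[mg /integrableP[_ fin]]].
  split; first by split.
  apply/integrableP; split; last by rewrite -cubeE//.
  by apply/measurable_EFinP; exact: measurable_sqmod.
by case: (mg) => mr mi; split; rewrite ?cubeE.
Qed.

(** Both parts of [g] are dominated by [1 + sqmod g], which is integrable because constants are, the
    measure being a probability. *)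
Lemma inL2_cintegrable m (g : m.-tuple R -> R[i]) : inL2 g -> cintegrable g.
Proof.
move=> /inL2P[[mr mi] ig].
have i1 := rintegrableD (rintegrable_cst m 1) ig.
split; apply: (le_integrable measurableT _ _ i1) => //.
- exact/measurable_EFinP.
- by move=> t _ /=; rewrite lee_fin (le_trans _ (ler_norm _))// normr_reC_le.
- exact/measurable_EFinP.
- by move=> t _ /=; rewrite lee_fin (le_trans _ (ler_norm _))// normr_imC_le.
Qed.

Lemma inL2_le m (g : m.-tuple R -> R[i]) (k : m.-tuple R -> R) :
  cmeasurable g -> rintegrable k -> (forall t, sqmod (g t) <= k t) -> inL2 g.
Proof.
move=> mg ik gk; apply/inL2P; split => //.
apply: (le_integrable measurableT _ _ ik) => //.
- by apply/measurable_EFinP; exact: measurable_sqmod.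
- move=> t _ /=; rewrite lee_fin ger0_norm ?sqmod_ge0//.
  exact: le_trans (gk t) (ler_norm _).
Qed.

Lemma inL2B m (g h : m.-tuple R -> R[i]) : inL2 g -> inL2 h ->
  inL2 (fun t => g t - h t).
Proof.
move=> /inL2P[mg ig] /inL2P[mh ih].
apply: (@inL2_le _ _ (fun t => 2 * sqmod (g t) + 2 * sqmod (h t))) => //.
- exact: cmeasurableB.
- by apply: rintegrableD; exact: rintegrableZ.
- by move=> t; exact: sqmodB_le.
Qed.

(** Jensen's inequality for the real and the imaginary part, added up. Stated for every measurable
    [g], it can be used on all slices of a function rather than on almost all of them. *)
Lemma sqmod_cint m (g : m.-tuple R -> R[i]) : cmeasurable g ->
  ((sqmod (cint g))%:E <= cube_int (fun t => (sqmod (g t))%:E))%E.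
Proof.
(* If the right side is infinite the bound is trivial; otherwise [g] is square integrable, hence
   integrable. *)
move=> mg; have [fin|] := ltP (cube_int (fun t => (sqmod (g t))%:E)) +oo%E;
  last by move=> /(le_trans (leey _)).
have gL2 : inL2 g by case: (mg) => mr mi; split.
have [ir ii] := inL2_cintegrable gL2.
have /inL2P[_ i2] := gL2.
have [mr mi] := mg.
have le_sq (r : m.-tuple R -> R) : measurable_fun setT r ->
    (forall t, r t ^+ 2 <= sqmod (g t)) -> rintegrable (fun t => r t ^+ 2).
  move=> mr' rg; apply: (le_integrable measurableT _ _ i2).
    by apply/measurable_EFinP; exact: measurable_funX.
  move=> t _ /=; rewrite lee_fin ger0_norm ?sqr_ge0//.
  exact: le_trans (rg t) (ler_norm _).
have ir2 : rintegrable (fun t => reC (g t) ^+ 2).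
  by apply: le_sq => // t; rewrite lerDl sqr_ge0.
have ii2 : rintegrable (fun t => imC (g t) ^+ 2).
  by apply: le_sq => // t; rewrite lerDr sqr_ge0.
rewrite (cube_int_rint i2) lee_fin (rintD ir2 ii2).
by apply: lerD; exact: rint_sqr.
Qed.

End SquareIntegrable.

(** * Exponentials and their orthogonality to constants *)

Section Exponentials.
Context {R : realType}.

Lemma expm2piD (s t : R) : expm2pi (s + t) = expm2pi s * expm2pi t.
Proof.
apply: eq_reC_imC; rewrite ?reCM ?imCM /= mulrDr ?cosD ?sinD; ring.
Qed.

Lemma expm2pi0 : expm2pi (0 : R) = 1.
Proof. by rewrite /expm2pi mulr0 cos0 sin0 oppr0. Qed.

Lemma sqmod_expm2pi (s : R) : sqmod (expm2pi s) = 1.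
Proof. by rewrite /sqmod /= sqrrN cos2Dsin2. Qed.

Lemma measurable_dotk m (k : m.-tuple int) :
  measurable_fun [set: m.-tuple R] (dotk k).
Proof.
apply: measurable_sum => j; apply: measurable_funM => //.
exact: measurable_tnth.
Qed.

Lemma cmeasurable_expm2pi m (k : m.-tuple int) :
  cmeasurable (fun x : m.-tuple R => expm2pi (dotk k x)).
Proof.
have m2 : measurable_fun setT (fun x : m.-tuple R => 2 * pi * dotk k x).
  by apply: measurable_funM => //; exact: measurable_dotk.
split=> /=.
  apply: (@measurableT_comp _ _ _ _ _ _ cos) m2.
  by apply: continuous_measurable_fun; exact: continuous_cos.
apply: measurable_funN; apply: (@measurableT_comp _ _ _ _ _ _ sin) m2.
by apply: continuous_measurable_fun; exact: continuous_sin.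
Qed.

Lemma inL2_expM m (g : m.-tuple R -> R[i]) (k : m.-tuple int) : inL2 g ->
  inL2 (fun x => g x * expm2pi (dotk k x)).
Proof.
move=> /inL2P[mg ig]; apply: (@inL2_le _ _ _ (fun x => sqmod (g x))) => //.
  by apply: cmeasurableM => //; exact: cmeasurable_expm2pi.
by move=> x; rewrite sqmodM sqmod_expm2pi mulr1.
Qed.

Lemma cintegrable_expm2pi m (k : m.-tuple int) :
  cintegrable (fun x : m.-tuple R => expm2pi (dotk k x)).
Proof.
apply: inL2_cintegrable; apply: (@inL2_le _ _ _ (fun=> 1)).
- exact: cmeasurable_expm2pi.
- exact: rintegrable_cst.
- by move=> x; rewrite sqmod_expm2pi.
Qed.

Lemma dotk0 m (k : m.-tuple int) (x : m.-tuple R) :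
  (forall j, tnth k j = 0) -> dotk k x = 0.
Proof. by move=> k0; apply: big1 => j _; rewrite k0 mul0r. Qed.

Lemma dotk_cons m (k : m.+1.-tuple int) (x : R) (t : m.-tuple R) :
  dotk k (cons_tuple x t) = (thead k)%:~R * x + dotk (behead_tuple k) t.
Proof.
rewrite /dotk big_ord_recl; congr (_ + _).
apply: eq_bigr => j _; rewrite tnthS; congr (_%:~R * _).
by rewrite {1}(tuple_eta k) tnthS.
Qed.

Lemma sin_2piz (n : int) : sin (2 * pi * n%:~R) = 0 :> R.
Proof.
have H (k : nat) : sin (2 * pi * k%:R) = 0 :> R.
  rewrite (_ : _ * _ = 0 + (pi *+ 2) *+ k); last first.
    by rewrite add0r -[RHS]mulr_natr mulr_natl.
  by rewrite (periodicn (@sinD2pi R)) sin0.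
by case: n => k; rewrite ?NegzE ?mulrNz ?mulrN ?sinN H ?oppr0.
Qed.

Lemma cos_2piz (n : int) : cos (2 * pi * n%:~R) = 1 :> R.
Proof.
have H (k : nat) : cos (2 * pi * k%:R) = 1 :> R.
  rewrite (_ : _ * _ = 0 + (pi *+ 2) *+ k); last first.
    by rewrite add0r -[RHS]mulr_natr mulr_natl.
  by rewrite (periodicn (@cosD2pi R)) cos0.
by case: n => k; rewrite ?NegzE ?mulrNz ?mulrN ?cosN H.
Qed.

Import numFieldNormedType.Exports.

(** The integrand has the shape of the real or imaginary part of a constant times a one-dimensional
    exponential. Its antiderivative takes equal values at [0] and [1], because [n] is an integer. *)
Lemma integral_trig (n : int) (a b : R) : n != 0 ->
  (\int[@lebesgue_measure R]_(x in `[0%R, 1%R[)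
     (a * cos (2 * pi * (n%:~R * x)) +
      b * sin (2 * pi * (n%:~R * x)))%:E = 0)%E.
Proof.
move=> n0; pose th : R := 2 * pi * n%:~R.
have th0 : th != 0.
  by rewrite !mulf_neq0 ?pnatr_eq0 ?intr_eq0// gt_eqF ?pi_gt0.
pose f (x : R) := a * cos (th * x) + b * sin (th * x).
pose F (x : R) := (a * sin (th * x) - b * cos (th * x)) / th.
have dth (x : R) : is_derive x 1 (fun y => th * y) th.
  have -> : (fun y : R => th * y) = th \*: (id : R -> R) by [].
  apply: is_derive_eq; exact: mulr1.
have dsin (x : R) : is_derive x 1 (fun y => sin (th * y)) (cos (th * x) * th).
  exact: (is_derive1_comp (f := sin)).
have dcos (x : R) : is_derive x 1 (fun y => cos (th * y)) (- sin (th * x) * th).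
  exact: (is_derive1_comp (f := cos)).
have dF (x : R) : is_derive x 1 F (f x).
  rewrite /F /f; apply: is_derive_eq.
  by rewrite scaler0 add0r /GRing.scale/=; field.
have cf : continuous f.
  move=> x; apply: differentiable_continuous; apply/derivable1_diffP.
  rewrite /f; exact: ex_derive.
have cF : continuous F.
  by move=> x; apply: differentiable_continuous; apply/derivable1_diffP.
transitivity (\int[@lebesgue_measure R]_(x in `[0%R, 1%R[) (f x)%:E)%E.
  by apply: eq_integral => x _; rewrite /f /th !mulrA.
rewrite integral_itv_bndo_bndc; last first.
  apply/measurable_EFinP/measurable_funTS.
  exact: continuous_measurable_fun.
rewrite (@continuous_FTC2 _ _ F)//.
- rewrite -EFinB /F mulr1 mulr0 /th sin_2piz cos_2piz sin0 cos0 subrr//.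
- exact: continuous_subspaceT.
- split.
  + by move=> x _; exact: ex_derive.
  + exact/cvg_at_right_filter/cF.
  + exact/cvg_at_left_filter/cF.
- by move=> x _; rewrite derive1E derive_val.
Qed.

(** Induction on [m]: integrating out all coordinates but the first leaves a one-dimensional
    exponential times the integral [c] over the others. *)
Lemma cint_expm2pi m (k : m.-tuple int) : (exists j, tnth k j != 0) ->
  cint (fun x : m.-tuple R => expm2pi (dotk k x)) = 0.
Proof.
elim: m k => [|m IH] k [j kj]; first by case: j kj.
pose c := cint (fun t : m.-tuple R => expm2pi (dotk (behead_tuple k) t)).
have [ire iim] := cintegrable_expm2pi (behead_tuple k).
have slice x : cint (fun t : m.-tuple R => expm2pi (dotk k (cons_tuple x t))) =
    expm2pi ((thead k)%:~R * x) * c.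
  rewrite -cintZ; last exact: cintegrable_expm2pi.
  by congr cint; apply/funext => t; rewrite dotk_cons expm2piD.
have slice_int x :
    cintegrable (fun t : m.-tuple R => expm2pi (dotk k (cons_tuple x t))).
  have := cintegrableZ (expm2pi ((thead k)%:~R * x))
    (cintegrable_expm2pi (behead_tuple k)).
  by congr cintegrable; apply/funext => t; rewrite dotk_cons expm2piD.
(* Here [r] stands for the real or the imaginary part, so that one argument serves both. *)
suff H (r : R[i] -> R) (rE : r = @reC R \/ r = @imC R) :
    (\int[@lebesgue_measure R]_(x in `[0%R, 1%R[)
       (r (expm2pi ((thead k)%:~R * x) * c))%:E = 0)%E.
  apply: eq_reC_imC.
    rewrite -[RHS]/(fine 0%E) -(H (@reC R)); last by left.
    rewrite reC_cint; congr fine; apply: eq_integral => x _.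
    by rewrite -slice reC_cint -cube_int_rint//; case: (slice_int x).
  rewrite -[RHS]/(fine 0%E) -(H (@imC R)); last by right.
  rewrite imC_cint; congr fine; apply: eq_integral => x _.
  by rewrite -slice imC_cint -cube_int_rint//; case: (slice_int x).
(* Either a later frequency is nonzero and [c] vanishes by induction, or the first frequency is
   nonzero and the integral over the first coordinate vanishes. *)
have [[i ki]|k0] := pselect (exists i, tnth (behead_tuple k) i != 0).
  rewrite /c IH; last by exists i.
  by apply: integral0_eq => x _; rewrite mulr0; case: rE => ->.
have h0 : thead k != 0.
  apply: contraPneq kj => h0; apply/negP; rewrite negbK.
  case: (unliftP ord0 j) => [i ->|->]; last exact/eqP.
  apply: contra_notT k0 => ki; exists i.
  by move: ki; rewrite {1}(tuple_eta k) tnthS.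
case: rE => ->.
  rewrite -[RHS](integral_trig (reC c) (imC c) h0); apply: eq_integral => x _.
  by rewrite reCM /=; congr EFin; ring.
rewrite -[RHS](integral_trig (imC c) (- reC c) h0); apply: eq_integral => x _.
by rewrite imCM /=; congr EFin; ring.
Qed.

End Exponentials.

(** * Extending frequencies by zero *)

Section Extension.
Context {R : realType} {d : nat}.
Variable u : {set 'I_d}.

Definition extend_freq (k : #|u|.-tuple int) : d.-tuple int :=
  [tuple (if i \in u then nth 0 k (index i (enum u)) else 0) | i < d].

Lemma tnth_extend_in k (j : 'I_#|u|) :
  tnth (extend_freq k) (enum_val j) = tnth k j.
Proof. by rewrite tnth_mktuple enum_valP index_enum_val (tnth_nth 0). Qed.

Lemma tnth_extend_out k i : i \notin u -> tnth (extend_freq k) i = 0.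
Proof. by rewrite tnth_mktuple => /negPf ->. Qed.

Lemma extend_freqK : cancel extend_freq (restr u).
Proof.
by move=> k; apply: eq_from_tnth => j; rewrite tnth_restr tnth_extend_in.
Qed.

Lemma dotk_merge (k : d.-tuple int) (y : #|u|.-tuple R)
    (z : #|~: u|.-tuple R) :
  dotk k (merge u y z) = dotk (restr u k) y + dotk (restr (~: u) k) z.
Proof.
rewrite /dotk (bigID (mem u))/=; congr (_ + _).
  rewrite (big_enum_val (fun i => (tnth k i)%:~R * tnth (merge u y z) i)).
  by apply: eq_bigr => j _; rewrite tnth_merge_in tnth_restr.
rewrite (eq_bigl (mem (~: u))); last by move=> i; rewrite !inE.
rewrite (big_enum_val (fun i => (tnth k i)%:~R * tnth (merge u y z) i)).
by apply: eq_bigr => j _; rewrite tnth_merge_out tnth_restr.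
Qed.

Lemma dotk_extend (k : #|u|.-tuple int) (y : #|u|.-tuple R)
    (z : #|~: u|.-tuple R) : dotk (extend_freq k) (merge u y z) = dotk k y.
Proof.
rewrite dotk_merge extend_freqK [X in _ + X]dotk0 ?addr0// => j.
rewrite tnth_restr tnth_extend_out//.
by have := enum_valP j; rewrite inE.
Qed.

End Extension.

(** * Fourier coefficients of projections and of ANOVA terms *)

Section Projection.
Context {R : realType} {d : nat}.
Implicit Types (u v : {set 'I_d}) (f g h : d.-tuple R -> R[i]).

Lemma cint_cst m (c : R[i]) : cint (fun _ : m.-tuple R => c) = c.
Proof. by apply: eq_reC_imC; rewrite ?reC_cint ?imC_cint rint_cst. Qed.

Lemma cube_int_cst m (c : R) : cube_int (fun _ : m.-tuple R => c%:E) = c%:E.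
Proof. by rewrite (cube_int_rint (rintegrable_cst m c)) rint_cst. Qed.

Lemma fourier_integrable m (g : m.-tuple R -> R[i]) (k : m.-tuple int) :
  inL2 g -> cintegrable (fun x => g x * expm2pi (dotk k x)).
Proof. by move=> gL2; apply: inL2_cintegrable; exact: inL2_expM. Qed.

Lemma fourierB m (g h : m.-tuple R -> R[i]) (k : m.-tuple int) :
  inL2 g -> inL2 h ->
  fourier (fun x => g x - h x) k = fourier g k - fourier h k.
Proof.
move=> gL2 hL2; rewrite /fourier -cintB; try exact: fourier_integrable.
by congr cint; apply/funext => x; rewrite mulrBl.
Qed.

(** [sqmod_cint] bounds the squared modulus of the projection at each [y] by the integral of
    [sqmod f] over the slice; Tonelli then integrates this bound to the finite integral of
    [sqmod f]. *)
Lemma inL2_Pproj v f : inL2 f -> inL2 (Pproj v f).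
Proof.
move=> fL2; have /inL2P[mf _] := fL2; have [_ _ fin] := fL2.
have mP : cmeasurable (Pproj v f) by exact: cmeasurable_cint_merge.
have msf : measurable_fun setT (fun x => (sqmod (f x))%:E).
  by apply/measurable_EFinP; exact: measurable_sqmod.
have [mr mi] := mP; split => //.
move: fin; rewrite (cube_int_merge_ge0 v) => [|//|x]; last first.
  by rewrite lee_fin sqmod_ge0.
apply: le_lt_trans; apply: le_cube_int.
- by apply/measurable_EFinP; exact: measurable_sqmod.
- exact (@measurable_cube_int_merge R d v (fun x => (sqmod (f x))%:E) msf).
- by move=> y; rewrite lee_fin sqmod_ge0.
- move=> y; apply: (@sqmod_cint _ _ (fun z => f (merge v y z))).
  have [mrf mif] := mf.
  by split; [apply: (measurableT_comp mrf)|apply: (measurableT_comp mif)];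
    exact: measurable_merge_snd.
Qed.

Lemma inL2_restr v (h : #|v|.-tuple R -> R[i]) : inL2 h ->
  inL2 (fun x => h (restr v x)).
Proof.
move=> [mr mi fin].
have mr' : measurable_fun setT (fun x => reC (h (restr v x))).
  by apply: (measurableT_comp mr); exact: measurable_restr.
have mi' : measurable_fun setT (fun x => imC (h (restr v x))).
  by apply: (measurableT_comp mi); exact: measurable_restr.
split => //; rewrite (cube_int_merge_ge0 v); last 2 first.
- by apply/measurable_EFinP; exact: measurable_sqmod.
- by move=> x; rewrite lee_fin sqmod_ge0.
congr (_ < +oo)%E : fin; congr cube_int; apply/funext => y.
by under [in RHS]eq_fun do rewrite restr_merge; rewrite cube_int_cst.
Qed.

Lemma inL2_ANOVA_PT v f : inL2 f -> inL2 (ANOVA_PT v f).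
Proof. by move=> fL2; apply: inL2_restr; exact: inL2_Pproj. Qed.

(** The projection does not depend on the coordinates outside [v], so integrating these first
    isolates the integral of an exponential with the frequencies of [k] outside [v]. It is [1] if
    they all vanish and [0] otherwise. *)
Lemma fourier_ANOVA_PT v f (k : d.-tuple int) : inL2 f ->
  fourier (ANOVA_PT v f) k =
  if [forall j, (j \notin v) ==> (tnth k j == 0)] then fourier f k else 0.
Proof.
move=> fL2.
have [_ gE] := cint_merge v (fourier_integrable k (inL2_ANOVA_PT v fL2)).
rewrite {1}/fourier gE {gE}.
have -> : (fun y => cint (fun z => ANOVA_PT v f (merge v y z) *
    expm2pi (dotk k (merge v y z)))) =
    (fun y => Pproj v f y * expm2pi (dotk (restr v k) y) *
      cint (fun z : #|~: v|.-tuple R => expm2pi (dotk (restr (~: v) k) z))).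
  apply/funext => y; rewrite -cintZ; last exact: cintegrable_expm2pi.
  congr cint; apply/funext => z.
  by rewrite /ANOVA_PT restr_merge dotk_merge expm2piD mulrA.
case: ifPn => [/forallP k0|].
  have e1 (z : #|~: v|.-tuple R) : expm2pi (dotk (restr (~: v) k) z) = 1.
    rewrite dotk0 ?expm2pi0// => j; rewrite tnth_restr.
    by apply/eqP; apply: (implyP (k0 _)); have := enum_valP j; rewrite inE.
  have -> : cint (fun z : #|~: v|.-tuple R =>
      expm2pi (dotk (restr (~: v) k) z)) = 1.
    by under [X in cint X]eq_fun do rewrite e1; rewrite cint_cst.
  have fi := fourier_integrable k fL2.
  have [ci fE] := cint_merge v fi; rewrite /fourier fE {fE}.
  (* Pulling the exponential in [y] out of the inner integral uses integrability of the slice of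
     [f], known for almost every [y] only. *)
  apply: (ae_cint ci).
    apply: cmeasurableM; last by split; exact: measurable_cst.
    apply: cmeasurableM; last exact: cmeasurable_expm2pi.
    by have /inL2P[] := inL2_Pproj v fL2.
  apply: filterS (cintegrable_merge v (inL2_cintegrable fL2)) => y fy.
  rewrite mulr1 mulrC -cintZ//; congr cint; apply/funext => z.
  by rewrite dotk_merge expm2piD e1 mulr1 mulrC.
rewrite negb_forall => /existsP[j]; rewrite negb_imply => /andP[jv kj].
rewrite cint_expm2pi; last first.
  case: (in_or_outP v j) jv kj => // i -> _ ki; exists i.
  by rewrite tnth_restr.
by under [X in cint X]eq_fun do rewrite mulr0; rewrite cint_cst.
Qed.

(** A property that projections have and that differences preserve, hence one that passes through
    the ANOVA recursion. The constant is a natural number so that [inH_section] can write it as a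
    sum of [C] copies. *)
Definition fourier_dominated f g : Prop := inL2 g /\
  exists C : nat, forall k, sqmod (fourier g k) <= C%:R * sqmod (fourier f k).

Lemma fourier_dominatedB f g h : fourier_dominated f g ->
  fourier_dominated f h -> fourier_dominated f (fun x => g x - h x).
Proof.
move=> [gL2 [C gC]] [hL2 [D hD]]; split; first exact: inL2B.
(* The factors [2] are those of [sqmodB_le]. *)
exists (2 * C + 2 * D)%N => k; rewrite fourierB//.
apply: (le_trans (sqmodB_le _ _)); rewrite natrD !natrM.
have := gC k; have := hD k; lra.
Qed.

(** The summands are subtracted from [g] one at a time, which calls for stability under differences
    only; [g] is therefore general in the induction. *)
Lemma fourier_dominated_subr_sum f (I : Type) (s : seq I) (P : pred I)
    (G : I -> d.-tuple R -> R[i]) g : fourier_dominated f g ->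
  (forall i, P i -> fourier_dominated f (G i)) ->
  fourier_dominated f (fun x => g x - \sum_(i <- s | P i) G i x).
Proof.
move=> + fG; elim: s g => [|i s IH] g fg.
  by under eq_fun do rewrite big_nil subr0.
have [Pi|nPi] := boolP (P i); last first.
  by under eq_fun do rewrite big_cons (negPf nPi); exact: IH.
under eq_fun do rewrite big_cons Pi opprD addrA.
by apply: IH; apply: fourier_dominatedB => //; exact: fG.
Qed.

Lemma fourier_dominated_ANOVA_PT v f : inL2 f ->
  fourier_dominated f (ANOVA_PT v f).
Proof.
move=> fL2; split; first exact: inL2_ANOVA_PT.
exists 1%N => k; rewrite mul1r fourier_ANOVA_PT//; case: ifP => // _.
by rewrite /sqmod /reC /imC/= expr0n addr0 addr_ge0// sqr_ge0.
Qed.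

Lemma fourier_dominated_anova_aux f n u : inL2 f ->
  fourier_dominated f (anova_aux f n u).
Proof.
move=> fL2; elim: n u => [|n IH] u /=; first exact: fourier_dominated_ANOVA_PT.
apply: fourier_dominated_subr_sum => //; exact: fourier_dominated_ANOVA_PT.
Qed.

(** The recursion only meets projections onto subsets of [v], hence of [u], and these read no
    coordinate of [z]. *)
Lemma anova_aux_merge f n u v (y : #|u|.-tuple R) (z z' : #|~: u|.-tuple R) :
  v \subset u ->
  anova_aux f n v (merge u y z) = anova_aux f n v (merge u y z').
Proof.
elim: n v => [|n IH] v vu /=.
  by rewrite /ANOVA_PT (restr_merge_sub _ _ z').
rewrite /ANOVA_PT (restr_merge_sub _ _ z')//; congr (_ - _).
apply: eq_bigr => v' /proper_sub v'v; apply: IH.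
exact: fintype.subset_trans v'v vu.
Qed.

(** The common last step for projections and ANOVA terms: a dominated function that depends on the
    coordinates in [u] only is viewed as a function of these, the others being frozen at [z0]. *)
Lemma inH_section u (w : d.-tuple int -> R) (wu : #|u|.-tuple int -> R) f g
    (z0 : #|~: u|.-tuple R) :
  weight wu -> (forall k, wu k <= w (extend_freq k)) ->
  inH w f -> fourier_dominated f g ->
  (forall y z z', g (merge u y z) = g (merge u y z')) ->
  inH wu (fun y => g (merge u y z0)).
Proof.
move=> wu1 wuw [fL2 ffin] [gL2 [C gC]] gz.
have /inL2P[mg _] := gL2; have [mr mi fin] := gL2.
have hL2 : inL2 (fun y => g (merge u y z0)).
  have mr' : measurable_fun setT (fun y => reC (g (merge u y z0))).
    by apply: (measurableT_comp mr); exact: measurable_merge_fst.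
  have mi' : measurable_fun setT (fun y => imC (g (merge u y z0))).
    by apply: (measurableT_comp mi); exact: measurable_merge_fst.
  split => //.
  move: fin; rewrite (cube_int_merge_ge0 u); last 2 first.
  - by apply/measurable_EFinP; exact: measurable_sqmod.
  - by move=> x; rewrite lee_fin sqmod_ge0.
  congr (_ < +oo)%E; congr cube_int; apply/funext => y.
  by under [in LHS]eq_fun do rewrite (gz _ _ z0); rewrite cube_int_cst.
split => //.
(* Neither [g] nor the exponential at the extended frequency depends on [z], so the inner integral
   is that of a constant. *)
have hE k : fourier (fun y => g (merge u y z0)) k = fourier g (extend_freq k).
  have [_ gE] := cint_merge u (fourier_integrable (extend_freq k) gL2).
  rewrite [RHS]/fourier gE.
  congr cint; apply/funext => y.
  under [in RHS]eq_fun do rewrite dotk_extend (gz _ _ z0).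
  by rewrite cint_cst.
pose a (k : d.-tuple int) := ((w k) ^+ 2 * sqmod (fourier f k))%:E.
have a0 k : (0 <= a k)%E by rewrite lee_fin mulr_ge0 ?sqr_ge0 ?sqmod_ge0.
(* The constant [C] becomes a finite sum, which is then exchanged with the infinite one. *)
apply: (@le_lt_trans _ _ (\esum_(k in [set: #|u|.-tuple int])
    \sum_(i < C) a (extend_freq k))%E).
  apply: le_esum => k _.
  rewrite /a /= sumEFin lee_fin sumr_const card_ord.
  rewrite hE -mulr_natl mulrCA.
  apply: (le_trans (ler_wpM2l (sqr_ge0 _) (gC _))).
  apply: ler_wpM2r; first by rewrite mulr_ge0 ?sqmod_ge0.
  have wu0 : 0 <= wu k := le_trans ler01 (wu1 k).
  by rewrite lerXn2r ?nnegrE// (le_trans wu0).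
rewrite esum_sum//.
apply: lte_sum_pinfty => _ _.
(* Extension by zero is injective, so what remains is the part of the series for [f] over the
   frequencies supported on [u]. *)
rewrite -(esum_image [set: #|u|.-tuple int] (@extend_freq d u) a); last first.
  by move=> k k' _ _; exact: (can_inj (@extend_freqK d u)).
apply: le_lt_trans ffin; rewrite esum_mkcond; apply: le_esum => k _.
by case: ifP => _; [exact: lexx|exact: a0].
Qed.

End Projection.

Theorem theorem3p10 (R : realType) (d : nat) (u : {set 'I_d})
  (w : d.-tuple int -> R) (f : d.-tuple R -> R[i]) :
  weight w -> inH w f ->
  forall wu : #|u|.-tuple int -> R,
    weight wu ->
    (forall k : d.-tuple int, (forall j, j \notin u -> tnth k j = 0) ->
       wu (restr u k) <= w k) ->
    inH wu (Pproj u f) /\ inH wu (anova_term u f).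
Proof.
move=> w1 Hf wu wu1 wuw; have fL2 := Hf.1.
have wuw' k : wu k <= w (extend_freq k).
  rewrite -{1}(extend_freqK k); apply: wuw => j.
  exact: tnth_extend_out.
split.
  (* The projection is rewritten as a section at [0] of a function of all variables, the form that
     [anova_term] has by definition. *)
  rewrite (_ : Pproj u f = fun y => ANOVA_PT u f (merge u y [tuple 0 | _ < _])).
    apply: inH_section wu1 wuw' Hf _ _; first exact: fourier_dominated_ANOVA_PT.
    by move=> y z z'; rewrite /ANOVA_PT !restr_merge.
  by apply/funext => y; rewrite /ANOVA_PT restr_merge.
apply: inH_section wu1 wuw' Hf _ _; first exact: fourier_dominated_anova_aux.
by move=> y z z'; exact: anova_aux_merge.
Qed.
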